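(* Let $p\le n$ be positive integers, $\rho>0$, $X\in\mathrm{Sp}(2p,2n)$ and $Y\in\mathbb{R}^{2n\times 2p}$. The orthogonal projections $\mathcal{P}_X(Y)$ of $Y$ onto $\mathrm{T}_X\mathrm{Sp}(2p,2n)$ and $\mathcal{P}_X^\perp(Y)$ of $Y$ onto $\left(\mathrm{T}_X\mathrm{Sp}(2p,2n)\right)^\perp$, with respect to $g_\rho$, have the expressions $$\mathcal{P}_X(Y)=XJ_{2p}\,\mathrm{sym}(X^\top J_{2n}^\top Y)+(I_{2n}-XJ_{2p}X^\top J_{2n}^\top)Y=S_{X,Y}J_{2n}X,$$ $$\mathcal{P}_X^\perp(Y)=XJ_{2p}\,\mathrm{skew}(X^\top J_{2n}^\top Y),$$ where $S_{X,Y}=G_XY(XJ_{2p})^\top+XJ_{2p}(G_XY)^\top$ and $G_X=I_{2n}-\frac12XJ_{2p}X^\top J_{2n}^\top$.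
   Context: For a positive integer $m$, $J_{2m}=\begin{bmatrix}0&I_m\\-I_m&0\end{bmatrix}$. For a square matrix $A$, $\mathrm{sym}(A)=\frac12(A+A^\top)$ and $\mathrm{skew}(A)=\frac12(A-A^\top)$. The symplectic Stiefel manifold is $\mathrm{Sp}(2p,2n)=\{X\in\mathbb{R}^{2n\times 2p}: X^\top J_{2n}X=J_{2p}\}$, an embedded submanifold of $\mathbb{R}^{2n\times 2p}$, with tangent space $\mathrm{T}_X\mathrm{Sp}(2p,2n)$ at $X$. Let $X_\perp\in\mathbb{R}^{2n\times(2n-2p)}$ be a full rank matrix whose columns span the orthogonal complement of the column span of $X$ (the empty matrix when $p=n$); then $E=[XJ_{2p}\;\;J_{2n}X_\perp]$ is invertible. The inner product $g_\rho$ (at $X$, depending also on the choice of $X_\perp$) on $\mathbb{R}^{2n\times 2p}$ is $g_\rho(Z_1,Z_2)=\mathrm{tr}(Z_1^\top B_XZ_2)$ with $B_X=E^{-\top}\begin{bmatrix}\frac1\rho I_{2p}&0\\0&I_{2n-2p}\end{bmatrix}E^{-1}$. The normal space is $\left(\mathrm{T}_X\mathrm{Sp}(2p,2n)\right)^\perp=\{N\in\mathbb{R}^{2n\times 2p}: g_\rho(N,Z)=0\text{ for all }Z\in\mathrm{T}_X\mathrm{Sp}(2p,2n)\}$. *)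

(* Defs.v *)
From mathcomp Require Import all_boot all_order all_algebra.
From mathcomp Require Import all_classical all_reals all_analysis.
Set Implicit Arguments.
Unset Strict Implicit.
Unset Printing Implicit Defensive.
Import Order.TTheory GRing.Theory Num.Theory.
Import numFieldNormedType.Exports.
Local Open Scope classical_set_scope.
Local Open Scope ring_scope.

(* Even dimensions 2m are written m + m, so that the block constructions of
   the matrix library apply without casts. *)

Definition symplJ (R : realType) (m : nat) : 'M[R]_(m + m) :=
  block_mx 0 1%:M (- 1%:M) 0.

Arguments symplJ {R} m.

Definition sympart (R : realType) (m : nat) (A : 'M[R]_m) : 'M[R]_m :=
  2^-1 *: (A + A^T).

Definition skewpart (R : realType) (m : nat) (A : 'M[R]_m) : 'M[R]_m :=
  2^-1 *: (A - A^T).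

Definition SpStiefel (R : realType) (p n : nat) : set 'M[R]_(n + n, p + p) :=
  [set X | X^T *m symplJ n *m X = symplJ p].

Arguments SpStiefel {R} p n.

Definition smooth_on (R : realType) (e : R) (f : R -> R) : Prop :=
  forall (k : nat) (t : R), - e < t < e -> derivable (derive1n k f) t 1.

(* The tangent space at X of an embedded submanifold M of a matrix space: the
   velocities at time 0 of the smooth curves ]-e, e[ -> M through X.  Smoothness
   and derivatives are taken entrywise; the values of gamma outside ]-e, e[ are
   irrelevant. *)
Definition tangent_space (R : realType) (a b : nat) (M : set 'M[R]_(a, b))
    (X : 'M[R]_(a, b)) : set 'M[R]_(a, b) :=
  [set Z | exists (e : R) (gamma : R -> 'M[R]_(a, b)),
    [/\ 0 < e,
        forall i j, smooth_on e (fun t => gamma t i j),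
        forall t, - e < t < e -> M (gamma t),
        gamma 0 = X
      & Z = \matrix_(i, j) derive1 (fun t => gamma t i j) 0]].

(* Xp has full rank and its column span is the orthogonal complement (for the
   standard inner product) of the column span of X. *)
Definition is_perp (R : realType) (a b c : nat) (X : 'M[R]_(a, b))
    (Xp : 'M[R]_(a, c)) : Prop :=
  \rank Xp = c /\
  forall v : 'cV[R]_a,
    (exists w : 'cV[R]_c, v = Xp *m w) <->
    (forall u : 'cV[R]_b, (X *m u)^T *m v = 0).

Lemma dim_splitE (p n : nat) (le_pn : (p <= n)%N) :
  (p + p + (n + n - (p + p)) = n + n)%N.
Proof. by rewrite subnKC // leq_add. Qed.

Definition frameE (R : realType) (p n : nat) (le_pn : (p <= n)%N)
    (X : 'M[R]_(n + n, p + p)) (Xp : 'M[R]_(n + n, n + n - (p + p))) :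
    'M[R]_(n + n) :=
  castmx (erefl, dim_splitE le_pn)
    (row_mx (X *m symplJ p) (symplJ n *m Xp)).

Definition metricB (R : realType) (p n : nat) (le_pn : (p <= n)%N) (rho : R)
    (X : 'M[R]_(n + n, p + p)) (Xp : 'M[R]_(n + n, n + n - (p + p))) :
    'M[R]_(n + n) :=
  (invmx (frameE le_pn X Xp))^T
    *m castmx (dim_splitE le_pn, dim_splitE le_pn)
         (block_mx (rho^-1)%:M 0 0 1%:M)
    *m invmx (frameE le_pn X Xp).

Definition g_rho (R : realType) (p n : nat) (le_pn : (p <= n)%N) (rho : R)
    (X : 'M[R]_(n + n, p + p)) (Xp : 'M[R]_(n + n, n + n - (p + p)))
    (Z1 Z2 : 'M[R]_(n + n, p + p)) : R :=
  \tr (Z1^T *m metricB le_pn rho X Xp *m Z2).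

Definition orth_space (R : realType) (a b : nat)
    (g : 'M[R]_(a, b) -> 'M[R]_(a, b) -> R) (V : set 'M[R]_(a, b)) :
    set 'M[R]_(a, b) :=
  [set N | forall Z, V Z -> g N Z = 0].

Definition is_orth_proj (R : realType) (a b : nat)
    (g : 'M[R]_(a, b) -> 'M[R]_(a, b) -> R) (V : set 'M[R]_(a, b))
    (Y P : 'M[R]_(a, b)) : Prop :=
  V P /\ orth_space g V (Y - P).

Definition matG (R : realType) (p n : nat) (X : 'M[R]_(n + n, p + p)) :
    'M[R]_(n + n) :=
  1%:M - 2^-1 *: (X *m symplJ p *m X^T *m (symplJ n)^T).

Definition matS (R : realType) (p n : nat) (X Y : 'M[R]_(n + n, p + p)) :
    'M[R]_(n + n) :=
  matG X *m Y *m (X *m symplJ p)^T + X *m symplJ p *m (matG X *m Y)^T.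

(* Main.v *)
Require Import Defs.
From mathcomp Require Import all_boot all_order all_algebra.
From mathcomp Require Import all_classical all_reals all_analysis.
From mathcomp Require Import ring.
Import Order.TTheory GRing.Theory Num.Theory.
Import numFieldNormedType.Exports.
Local Open Scope classical_set_scope.
Local Open Scope ring_scope.

(** Write D = X^T J^T, so that D (X J) = 1 on the symplectic Stiefel manifold.

    The tangent space at X consists of the Z for which D Z is symmetric
    (tangent_spaceE).  Differentiating X^T J X = J along a curve gives one
    inclusion.  Conversely, if D Z is symmetric then Z = K X with K = S_(X,Z) J
    Hamiltonian (matS_JX), and Z is the velocity at 0 of the curve C(t) X,
    where C(t) = (1 - t K / 2)^-1 (1 + t K / 2) is the Cayley transform.  The
    Cayley transform preserves the symplectic form, and its entries are
    quotients of polynomials in t, hence smooth as long as the determinant of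
    1 - t K / 2 does not vanish.

    The inverse of the frame E = [X J, J Xp] is explicit: its top block is D
    and its bottom block is some M with M (X J) = 0.  Therefore (g_rhoE)
      g_rho Z1 Z2 = rho^-1 tr ((D Z1)^T (D Z2)) + tr ((M Z1)^T (M Z2)),
    which is visibly symmetric and positive definite.  For skew W the matrix
    N = X J W satisfies D N = W and M N = 0, so pairing N with a tangent vector
    Z gives the trace of a skew matrix times a symmetric one, which is zero.

    With A = D Y, the proposed tangent component of Y is Y - X J skew A: it is
    tangent because D of it is A - skew A = sym A, and X J skew A is normal by
    the previous remark.  Positive definiteness makes both projections
    unique. *)

Set Implicit Arguments.
Unset Strict Implicit.
Unset Printing Implicit Defensive.

(** * Algebra of the symplectic form *)

Lemma tr_symplJ (R : realType) m : (symplJ m)^T = - symplJ m :> 'M[R]_(m + m).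
Proof.
by rewrite /symplJ tr_block_mx opp_block_mx !trmx0 linearN /= trmx1 oppr0 opprK.
Qed.

Lemma mul_symplJ (R : realType) m :
  symplJ m *m symplJ m = - 1%:M :> 'M[R]_(m + m).
Proof.
rewrite /symplJ mulmx_block !mul0mx !mulmx0 !mul1mx !mulmx1 !add0r !addr0.
by rewrite scalar_mx_block opp_block_mx oppr0.
Qed.

Lemma tr_symplJ_mul (R : realType) m :
  (symplJ m)^T *m symplJ m = 1%:M :> 'M[R]_(m + m).
Proof. by rewrite tr_symplJ mulNmx mul_symplJ opprK. Qed.

(** Multiplied on the left by J, this is the symplectic left inverse J^T X^T J of
    X.  Without that factor it reads off the X J coordinates, in which tangency
    is symmetry. *)
Definition symplD (R : realType) (p n : nat) (X : 'M[R]_(n + n, p + p)) :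
  'M[R]_(p + p, n + n) := X^T *m (symplJ n)^T.

Lemma symplD_XJ (R : realType) p n (X : 'M[R]_(n + n, p + p)) :
  SpStiefel p n X -> symplD X *m (X *m symplJ p) = 1%:M.
Proof.
move=> XSp; rewrite /symplD tr_symplJ mulmxN mulNmx mulmxA XSp.
by rewrite mul_symplJ opprK.
Qed.

Lemma tr_symplDM (R : realType) p n (X Y : 'M[R]_(n + n, p + p)) :
  (symplD X *m Y)^T = Y^T *m symplJ n *m X.
Proof. by rewrite /symplD !trmx_mul !trmxK mulmxA. Qed.

Lemma proj_tangentE (R : realType) p n (X Y : 'M[R]_(n + n, p + p)) :
  let A := symplD X *m Y in
  X *m symplJ p *m sympart A
    + (1%:M - X *m symplJ p *m X^T *m (symplJ n)^T) *m Y
  = Y - X *m symplJ p *m skewpart A.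
Proof.
move=> A; rewrite mulmxBl mul1mx addrCA; congr (_ + _).
have -> : X *m symplJ p *m X^T *m (symplJ n)^T *m Y = X *m symplJ p *m A.
  by rewrite /A /symplD !mulmxA.
rewrite -mulmxBr -(mulmxN (X *m _)); congr (mulmx _ _).
rewrite /sympart /skewpart; apply/matrixP => i j; rewrite !mxE.
by field.
Qed.

(** The two halves of S contribute Y - X J A / 2 and X J A^T / 2, with A = D Y:
    the factor 1/2 in G is what makes them add up to Y - X J skew A. *)
Lemma matS_JX (R : realType) p n (X Y : 'M[R]_(n + n, p + p)) :
  SpStiefel p n X ->
  matS X Y *m symplJ n *m X = Y - X *m symplJ p *m skewpart (symplD X *m Y).
Proof.
move=> XSp; set A := symplD X *m Y.
have GY : matG X *m Y = Y - 2^-1 *: (X *m symplJ p *m A).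
  by rewrite /matG mulmxBl mul1mx -scalemxAl /A /symplD !mulmxA.
have S1 : (X *m symplJ p)^T *m symplJ n *m X = 1%:M.
  by rewrite trmx_mul -!mulmxA (mulmxA X^T) XSp tr_symplJ_mul.
have S2 : (matG X *m Y)^T *m symplJ n *m X = 2^-1 *: A^T.
  rewrite -tr_symplDM GY mulmxBr -scalemxAr mulmxA symplD_XJ // mul1mx -/A.
  by apply/matrixP => i j; rewrite !mxE; field.
have assoc b (U : 'M[R]_(n + n, b)) (W : 'M[R]_(b, n + n)) (K : 'M[R]_(n + n)) :
    U *m W *m K *m X = U *m (W *m K *m X) by rewrite !mulmxA.
(* Without abstracting G Y, distributivity would also expand G itself. *)
rewrite /matS; move: (matG X *m Y) GY S2 => G GY S2.
rewrite 2!mulmxDl !assoc S1 mulmx1 S2 GY.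
rewrite -scalemxAr /skewpart -scalemxAr mulmxBr -addrA; congr (_ + _).
by rewrite scalerBr opprB addrC.
Qed.

Lemma tr_skewpart (R : realType) m (A : 'M[R]_m) :
  (skewpart A)^T = - skewpart A.
Proof. by apply/matrixP => i j; rewrite !mxE; field. Qed.

Lemma skewpart_eq0 (R : realType) m (A : 'M[R]_m) : A^T = A -> skewpart A = 0.
Proof. by move=> At; rewrite /skewpart At subrr scaler0. Qed.

Lemma tr_matS (R : realType) p n (X Y : 'M[R]_(n + n, p + p)) :
  (matS X Y)^T = matS X Y.
Proof.
rewrite /matS; move: (matG X *m Y) (X *m symplJ p) => P Q.
by rewrite linearD /= !trmx_mul !trmxK addrC.
Qed.

Lemma hamiltonian_symJ (R : realType) n (S : 'M[R]_(n + n)) :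
  S^T = S ->
  (S *m symplJ n)^T *m symplJ n = - (symplJ n *m (S *m symplJ n)).
Proof. by move=> St; rewrite trmx_mul St tr_symplJ !mulNmx mulmxA. Qed.

(** * Entrywise differentiation of matrix-valued functions *)

Lemma near_itv_opp (R : realType) (e t : R) : - e < t < e ->
  \forall s \near t, - e < s < e.
Proof.
move=> te; have : t \in `]- e, e[ by rewrite in_itv.
move=> /near_in_itvoo; apply: filterS => s.
by rewrite in_itv.
Qed.

Definition mx_is_derive (R : realType) a b (F : R -> 'M[R]_(a, b)) (t : R)
  (dF : 'M[R]_(a, b)) : Prop :=
  forall i j, is_derive t 1 (fun s => F s i j) (dF i j).

Lemma mx_is_derive_cst (R : realType) a b (A : 'M[R]_(a, b)) t :
  mx_is_derive (fun=> A) t 0.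
Proof. by move=> i j; rewrite mxE; exact: is_derive_cst. Qed.

Lemma mx_is_derive_tr (R : realType) a b (F : R -> 'M[R]_(a, b)) t dF :
  mx_is_derive F t dF -> mx_is_derive (fun s => (F s)^T) t dF^T.
Proof.
move=> dFt i j; rewrite mxE.
by under eq_fun do rewrite mxE.
Qed.

Lemma mx_is_derive_mul (R : realType) a b c (F : R -> 'M[R]_(a, b))
    (G : R -> 'M[R]_(b, c)) t dF dG :
  mx_is_derive F t dF -> mx_is_derive G t dG ->
  mx_is_derive (fun s => F s *m G s) t (dF *m G t + F t *m dG).
Proof.
move=> dFt dGt i j.
have -> : (fun s => (F s *m G s) i j) =
    \sum_k ((fun s => F s i k) * (fun s => G s k j)).
  by apply/funext => s; rewrite mxE fct_sumE.
rewrite !mxE -big_split /=.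
apply: is_derive_eq; first by apply: is_derive_sum => k; apply: is_deriveM.
by apply: eq_bigr => k _; rewrite addrC /GRing.scale /= (mulrC (G _ _ _)).
Qed.

Lemma mx_is_derive_near (R : realType) a b (F G : R -> 'M[R]_(a, b)) t dF dG :
  (\near t, F t = G t) -> mx_is_derive F t dF -> mx_is_derive G t dG -> dF = dG.
Proof.
move=> FG dFt dGt; apply/matrixP => i j.
case: (dFt i j) => _ <-; case: (dGt i j) => _ <-.
by apply: near_eq_derive; near=> s; congr (fun_of_matrix _ _ _); near: s.
Unshelve. all: by end_near. Qed.

Lemma derivable_mx_is_derive (R : realType) a b (F : R -> 'M[R]_(a, b)) t :
  (forall i j, derivable (fun s => F s i j) t 1) ->
  mx_is_derive F t (\matrix_(i, j) derive1 (fun s => F s i j) t).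
Proof.
by move=> dF i j; apply: DeriveDef; [exact: dF|rewrite mxE derive1E].
Qed.

(** * Smoothness of rational functions *)

(** This class of functions is closed under derivation, which is what an
    induction on the order of differentiation needs.  The formula is required
    only on the interval, since the derivative at a point sees nothing else. *)
Definition rational_on (R : realType) (e : R) (f : R -> R) : Prop :=
  exists p q : {poly R}, forall t, - e < t < e ->
    q.[t] != 0 /\ f t = p.[t] / q.[t].

Lemma rational_on_derive (R : realType) (e : R) (f : R -> R) :
  rational_on e f ->
  (forall t, - e < t < e -> derivable f t 1) /\ rational_on e (derive1 f).
Proof.
case=> p [q fpq].
have der t : - e < t < e ->
    is_derive t 1 f ((p^`() * q - p * q^`()).[t] / (q ^+ 2).[t]).
  move=> te; have [qt0 _] := fpq t te.
  apply: (@near_eq_is_derive _ _ _ (fun s => p.[s] * q.[s]^-1)).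
    by near=> s; apply/esym; apply: (fpq s _).2; near: s; exact: near_itv_opp.
  have dq : is_derive t (1 : R) (fun s => q.[s]^-1) (- q.[t] ^- 2 *: q^`().[t]).
    have dhq : derivable (horner q) t 1 by exact: derivable_horner.
    apply: DeriveDef; first exact: (derivableV (f := horner q)).
    by rewrite (deriveV (f := horner q)) ?derivE ?derive1E.
  apply: is_derive_eq.
  rewrite !(hornerE, horner_exp) /GRing.scale /=; field.
  exact: qt0.
split=> [t /der [] //|].
exists (p^`() * q - p * q^`()), (q ^+ 2) => t te; split.
  by rewrite horner_exp expf_neq0 //; case: (fpq t te).
by rewrite derive1E; case: (der t te).
Unshelve. all: by end_near. Qed.

Lemma rational_on_smooth (R : realType) (e : R) (f : R -> R) :
  rational_on e f -> smooth_on e f.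
Proof.
move=> ratf k; apply: (rational_on_derive _).1.
by elim: k => // k /rational_on_derive[].
Qed.

(** * The Cayley transform *)

Definition halfshift (R : realType) m (K : 'M[R]_m) (t : R) : 'M[R]_m :=
  1%:M + (t / 2) *: K.

Definition cayley (R : realType) m (K : 'M[R]_m) (t : R) : 'M[R]_m :=
  invmx (halfshift (- K) t) *m halfshift K t.

(** The matrix of polynomials in t that evaluates to halfshift K t; it makes the
    determinant and the adjugate of the latter polynomial in t. *)
Definition halfshift_poly (R : realType) m (K : 'M[R]_m) : 'M[{poly R}]_m :=
  1%:M + (2^-1 *: 'X) *: map_mx polyC K.

Lemma halfshift0 (R : realType) m (K : 'M[R]_m) : halfshift K 0 = 1%:M.
Proof. by rewrite /halfshift mul0r scale0r addr0. Qed.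

Lemma horner_halfshift_poly (R : realType) m (K : 'M[R]_m) t i j :
  (halfshift_poly K i j).[t] = halfshift K t i j.
Proof.
rewrite !mxE !hornerE (mulrC t).
by congr (_ + _); case: eqP; rewrite hornerE.
Qed.

Lemma map_halfshift_poly (R : realType) m (K : 'M[R]_m) t :
  map_mx (horner_eval t) (halfshift_poly K) = halfshift K t.
Proof. by apply/matrixP => i j; rewrite mxE -horner_halfshift_poly. Qed.

Lemma det_halfshift_poly (R : realType) m (K : 'M[R]_m) t :
  (\det (halfshift_poly K)).[t] = \det (halfshift K t).
Proof. by rewrite -map_halfshift_poly det_map_mx. Qed.

Lemma mx_is_derive_halfshift (R : realType) m (K : 'M[R]_m) t :
  mx_is_derive (halfshift K) t (2^-1 *: K).
Proof.
move=> i j.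
have -> : (fun s : R => halfshift K s i j) = horner (halfshift_poly K i j).
  by apply/funext => s; rewrite horner_halfshift_poly.
apply: DeriveDef; first exact: derivable_horner.
rewrite -derive1E -derivE !mxE derivD derivM derivZ derivX derivC.
have -> : (i == j)%:R^`() = 0 :> {poly R} by case: eqP; rewrite ?deriv0 ?derivC.
by rewrite !hornerE.
Qed.

Lemma halfshift_unit_near0 (R : realType) m (K : 'M[R]_m) :
  exists2 e : R, 0 < e &
    forall t, - e < t < e -> halfshift K t \in unitmx.
Proof.
have d0 : (\det (halfshift_poly K)).[0] != 0.
  by rewrite det_halfshift_poly halfshift0 det1 oner_neq0.
have := @continuous_horner R (\det (halfshift_poly K)) 0.
move=> /cvgr_neq0/(_ d0) /nbhs_ballP [e /= e0 ball_e].
exists e => // t te; rewrite unitmxE unitfE -det_halfshift_poly.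
by apply: ball_e; rewrite /ball /= sub0r normrN ltr_norml.
Qed.

Lemma cayley_rational (R : realType) m b (K : 'M[R]_m) (X : 'M[R]_(m, b))
    (e : R) i j :
  (forall t, - e < t < e -> halfshift (- K) t \in unitmx) ->
  rational_on e (fun t => (cayley K t *m X) i j).
Proof.
move=> unitK.
pose N := \adj (halfshift_poly (- K)) *m halfshift_poly K *m map_mx polyC X.
exists (N i j), (\det (halfshift_poly (- K))) => t /unitK uKt.
rewrite det_halfshift_poly; split; first by rewrite -unitfE -unitmxE.
have -> : (N i j).[t] = (map_mx (horner_eval t) N) i j by rewrite [RHS]mxE.
have mapX : map_mx (horner_eval t) (map_mx polyC X) = X.
  by apply/matrixP => k l; rewrite !mxE /horner_eval hornerE.
(* Over a field, the inverse is the adjugate divided by the determinant. *)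
rewrite /N !map_mxM map_mx_adj !map_halfshift_poly mapX /cayley /invmx uKt.
by rewrite -!scalemxAl [LHS]mxE mulrC.
Qed.

Lemma cayley0 (R : realType) m (K : 'M[R]_m) : cayley K 0 = 1%:M.
Proof. by rewrite /cayley !halfshift0 mulmx1 invmx1. Qed.

(** Differentiating (1 - t K / 2) C(t) X = (1 + t K / 2) X avoids any formula for
    the derivative of an inverse. *)
Lemma cayley_derive0 (R : realType) m b (K : 'M[R]_m) (X V : 'M[R]_(m, b)) :
  mx_is_derive (fun t => cayley K t *m X) 0 V -> V = K *m X.
Proof.
move=> dC.
have dL : mx_is_derive (fun t => halfshift (- K) t *m (cayley K t *m X))
    0 (2^-1 *: (- K) *m X + V).
  have := mx_is_derive_mul (mx_is_derive_halfshift (- K) 0) dC.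
  by rewrite cayley0 halfshift0 !mul1mx.
have dR : mx_is_derive (fun t => halfshift K t *m X) 0 (2^-1 *: K *m X).
  have := mx_is_derive_mul (mx_is_derive_halfshift K 0) (mx_is_derive_cst X 0).
  by rewrite mulmx0 addr0.
have [e e0 unitK] := halfshift_unit_near0 (- K).
have : 2^-1 *: (- K) *m X + V = 2^-1 *: K *m X.
  apply: mx_is_derive_near dL dR; near=> t.
  rewrite mulmxA /cayley mulmxA mulmxV ?mul1mx //; apply: unitK.
  by near: t; apply: near_itv_opp; rewrite e0 oppr_lt0 e0.
move=> /(canRL (addKr _)) ->.
rewrite scalerN mulNmx opprK -!scalemxAl -scalerDl.
by rewrite -[2^-1]div1r -splitr scale1r.
Unshelve. all: by end_near. Qed.

Lemma halfshift_comm (R : realType) m (K : 'M[R]_m) t :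
  halfshift (- K) t *m halfshift K t = halfshift K t *m halfshift (- K) t.
Proof.
rewrite /halfshift !mulmxDl !mulmxDr !mulmx1 !mul1mx -!scalemxAl -!scalemxAr.
by rewrite mulNmx mulmxN -!addrA; congr (_ + _); rewrite addrCA.
Qed.

Lemma halfshift_tr_sympl (R : realType) m (J K : 'M[R]_m) t :
  K^T *m J = - (J *m K) -> (halfshift K t)^T *m J = J *m halfshift (- K) t.
Proof.
move=> KJ; rewrite /halfshift [(_ + _)^T]linearD /= trmx1 [(_ *: _)^T]linearZ /=.
by rewrite mulmxDl mulmxDr mul1mx mulmx1 -scalemxAl KJ -scalemxAr mulmxN.
Qed.

(** For Hamiltonian K, moving J across the transpose of 1 + t K / 2 turns it into
    1 - t K / 2, which cancels the inverse in C(t). *)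
Lemma cayley_sympl (R : realType) m (J K : 'M[R]_m) t :
  K^T *m J = - (J *m K) -> halfshift (- K) t \in unitmx ->
  (cayley K t)^T *m J *m cayley K t = J.
Proof.
move=> KJ uA; have NKJ : (- K)^T *m J = - (J *m - K).
  by rewrite linearN /= mulNmx KJ mulmxN.
have := halfshift_tr_sympl t NKJ; rewrite opprK.
have := halfshift_tr_sympl t KJ; have := halfshift_comm K t.
rewrite /cayley; move: uA.
move: (halfshift (- K) t) (halfshift K t) => A B uA AB BJ AJ.
have AVB : invmx A *m B = B *m invmx A.
  by apply: (can_inj (mulKmx uA)); rewrite mulKVmx // mulmxA AB mulmxK.
rewrite {1}AVB trmx_mul -(mulmxA _ B^T) BJ !mulmxA -(mulmxA _ A).
have uAT : A^T \in unitmx by rewrite unitmx_tr.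
by rewrite mulmxV // mulmx1 trmx_inv -mulmxA -AJ mulKmx.
Qed.

(** * The tangent space of the symplectic Stiefel manifold *)

(** Since Z^T J X + X^T J Z = (D Z)^T - D Z, this is the kernel at X of the
    linearization of X^T J X = J. *)
Definition symplTangent (R : realType) p n (X : 'M[R]_(n + n, p + p)) :
  set 'M[R]_(n + n, p + p) :=
  [set Z | (symplD X *m Z)^T = symplD X *m Z].

Lemma symplTangentB (R : realType) p n (X A B : 'M[R]_(n + n, p + p)) :
  symplTangent X A -> symplTangent X B -> symplTangent X (A - B).
Proof.
by rewrite /symplTangent /= mulmxBr [(_ - _)^T]linearB /= => -> ->.
Qed.

Lemma tangent_spaceE (R : realType) p n (X : 'M[R]_(n + n, p + p)) :
  SpStiefel p n X -> tangent_space (SpStiefel p n) X = symplTangent X.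
Proof.
move=> XSp; apply/seteqP; split=> [Z|Z TZ].
  case=> e [gamma [e0 smg Sg g0 ZE]].
  have I0 : - e < 0 < e by rewrite oppr_lt0 e0.
  have dg : mx_is_derive gamma 0 Z.
    by rewrite ZE; apply: derivable_mx_is_derive => i j;
      exact: (smg i j 0%N 0 I0).
  have dgJg := mx_is_derive_mul
    (mx_is_derive_mul (mx_is_derive_tr dg) (mx_is_derive_cst (symplJ n) 0)) dg.
  have gJg : \forall t \near (0 : R),
      (gamma t)^T *m symplJ n *m gamma t = symplJ p.
    by near=> t; apply: Sg; near: t; exact: near_itv_opp.
  have := mx_is_derive_near gJg dgJg (mx_is_derive_cst (symplJ p) 0).
  rewrite mulmx0 addr0 g0 /symplTangent /= tr_symplDM => /eqP.
  by rewrite addr_eq0 => /eqP ->; rewrite /symplD tr_symplJ mulmxN mulNmx.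
pose K := matS X Z *m symplJ n.
have KX : K *m X = Z by rewrite matS_JX // skewpart_eq0 // mulmx0 subr0.
have [e e0 unitK] := halfshift_unit_near0 (- K).
have ratC := cayley_rational X _ _ unitK.
exists e, (fun t => cayley K t *m X); split=> //.
- by move=> i j; apply: rational_on_smooth.
- move=> t /unitK uK; rewrite /SpStiefel /=.
  have KJ := hamiltonian_symJ (tr_matS X Z).
  have := cayley_sympl KJ uK; move: (cayley K t) => C CJC.
  by rewrite trmx_mul !mulmxA -(mulmxA X^T) -(mulmxA X^T) CJC.
- by rewrite cayley0 mul1mx.
rewrite -[LHS]KX; apply/esym/cayley_derive0/derivable_mx_is_derive => i j.
by apply: (rational_on_derive (ratC i j)).1; rewrite oppr_lt0 e0.
Unshelve. all: by end_near. Qed.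

(** * The metric *)

(** In this lemma and the next two the dimension d stays a variable, so that the
    casts disappear when the equation e is eliminated. *)
Lemma invmx_cast_row_mx (R : fieldType) a c d (e : (a + c)%N = d)
   (A : 'M[R]_(d, a)) (B : 'M[R]_(d, c)) (L : 'M[R]_(a, d)) (M : 'M[R]_(c, d)) :
  L *m A = 1%:M -> L *m B = 0 -> M *m A = 0 -> M *m B = 1%:M ->
  invmx (castmx (erefl, e) (row_mx A B)) = castmx (e, erefl) (col_mx L M).
Proof.
case: _ / e in A B L M * => LA LB MA MB; rewrite !castmx_id.
have H : col_mx L M *m row_mx A B = 1%:M.
  by rewrite mul_col_row LA LB MA MB -scalar_mx_block.
have [_ U] := mulmx1_unit H.
by rewrite -[LHS]mul1mx -H mulmxK.
Qed.

Lemma block_gram (R : realType) a c d (e : (a + c)%N = d) (r : R)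
   (L : 'M[R]_(a, d)) (M : 'M[R]_(c, d)) :
  (castmx (e, erefl) (col_mx L M))^T
    *m castmx (e, e) (block_mx r%:M 0 0 1%:M)
    *m castmx (e, erefl) (col_mx L M) = r *: (L^T *m L) + M^T *m M.
Proof.
case: _ / e in L M *; rewrite !castmx_id tr_col_mx mul_row_block.
by rewrite !mulmx0 addr0 add0r mul_row_col mulmx1 mul_mx_scalar -scalemxAl.
Qed.

Lemma left_inv_row_mx_inj (R : fieldType) a c d b (e : (a + c)%N = d)
   (A : 'M[R]_(d, a)) (B : 'M[R]_(d, c)) (L : 'M[R]_(a, d)) (M : 'M[R]_(c, d))
   (Z : 'M[R]_(d, b)) :
  L *m A = 1%:M -> L *m B = 0 -> M *m A = 0 -> M *m B = 1%:M ->
  L *m Z = 0 -> M *m Z = 0 -> Z = 0.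
Proof.
case: _ / e in A B L M Z * => LA LB MA MB LZ MZ.
have H : col_mx L M *m row_mx A B = 1%:M.
  by rewrite mul_col_row LA LB MA MB -scalar_mx_block.
by rewrite -[Z]mul1mx -(mulmx1C H) -mulmxA mul_col_mx LZ MZ col_mx0 mulmx0.
Qed.

Lemma is_perp_mul0 (R : realType) a b c (X : 'M[R]_(a, b)) (Xp : 'M[R]_(a, c)) :
  is_perp X Xp -> X^T *m Xp = 0.
Proof.
case=> _ perp; apply/matrixP => i j.
have /perp/(_ (delta_mx i 0)) : exists w : 'cV_c, Xp *m delta_mx j 0 = Xp *m w.
  by eexists.
rewrite trmx_mul trmx_delta -mulmxA (mulmxA X^T) -colE -rowE.
by move=> /matrixP/(_ 0 0); rewrite !mxE.
Qed.

(** The bottom block of the inverse frame is a left inverse of J Xp composed with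
    the projection that kills X J; the second property of M is the injectivity
    of the inverse frame. *)
Lemma g_rhoE (R : realType) (p n : nat) (le_pn : (p <= n)%N) (rho : R)
    (X : 'M[R]_(n + n, p + p)) (Xp : 'M[R]_(n + n, n + n - (p + p))) :
  SpStiefel p n X -> is_perp X Xp ->
  exists M : 'M[R]_(n + n - (p + p), n + n),
  [/\ M *m (X *m symplJ p) = 0,
      forall b (Z : 'M[R]_(n + n, b)), symplD X *m Z = 0 -> M *m Z = 0 -> Z = 0
    & forall Z1 Z2, g_rho le_pn rho X Xp Z1 Z2 =
        rho^-1 * \tr ((symplD X *m Z1)^T *m (symplD X *m Z2))
        + \tr ((M *m Z1)^T *m (M *m Z2))].
Proof.
move=> XSp perp.
have [B XpB] : exists B, Xp^T *m B = 1%:M.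
  by apply/row_freeP; rewrite /row_free mxrank_tr perp.1.
pose M := B^T *m (symplJ n)^T *m (1%:M - X *m symplJ p *m symplD X).
have DE1 := symplD_XJ XSp.
have DE2 : symplD X *m (symplJ n *m Xp) = 0.
  rewrite /symplD -mulmxA (mulmxA (symplJ n)^T) tr_symplJ_mul mul1mx.
  exact: is_perp_mul0.
have ME1 : M *m (X *m symplJ p) = 0.
  rewrite /M -mulmxA mulmxBl mul1mx -(mulmxA _ (symplD X)) DE1 mulmx1.
  by rewrite subrr mulmx0.
have ME2 : M *m (symplJ n *m Xp) = 1%:M.
  rewrite /M -mulmxA mulmxBl mul1mx -(mulmxA _ (symplD X)) DE2 mulmx0 subr0.
  rewrite -mulmxA (mulmxA (symplJ n)^T) tr_symplJ_mul mul1mx.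
  by apply: trmx_inj; rewrite trmx_mul trmxK XpB trmx1.
exists M; split=> // [b Z|Z1 Z2].
  exact: (left_inv_row_mx_inj (dim_splitE le_pn) DE1 DE2 ME1 ME2).
rewrite /g_rho /metricB /frameE (invmx_cast_row_mx _ DE1 DE2 ME1 ME2) block_gram.
rewrite mulmxDr mulmxDl mxtraceD -scalemxAr -scalemxAl mxtraceZ.
by rewrite !trmx_mul !mulmxA.
Qed.

Lemma mxtrace_gram_ge0 (R : realDomainType) a b (A : 'M[R]_(a, b)) :
  0 <= \tr (A^T *m A).
Proof.
apply: sumr_ge0 => i _; rewrite mxE; apply: sumr_ge0 => j _.
by rewrite mxE -expr2 sqr_ge0.
Qed.

Lemma mxtrace_gram_eq0 (R : realDomainType) a b (A : 'M[R]_(a, b)) :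
  \tr (A^T *m A) = 0 -> A = 0.
Proof.
move=> /psumr_eq0P tr0; apply/matrixP => i j; rewrite mxE.
have : (A^T *m A) j j = 0.
  apply: tr0 => // k _; rewrite mxE; apply: sumr_ge0 => l _.
  by rewrite mxE -expr2 sqr_ge0.
rewrite mxE => /psumr_eq0P Aj0.
have /eqP : A^T j i * A i j = 0.
  by apply: Aj0 => // k _; rewrite mxE -expr2 sqr_ge0.
by rewrite !mxE mulf_eq0 orbb => /eqP.
Qed.

Lemma mxtrace_skew_sym (R : numDomainType) m (K W : 'M[R]_m) :
  K^T = - K -> W^T = W -> \tr (K^T *m W) = 0.
Proof.
move=> Kt Wt; apply/eqP.
have : \tr (K^T *m W) == - \tr (K^T *m W).
  rewrite -{1}mxtrace_tr trmx_mul trmxK Wt mxtrace_mulC Kt mulNmx.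
  by rewrite [\tr (- _)]linearN opprK.
by rewrite -addr_eq0 -mulr2n mulrn_eq0.
Qed.

Lemma g_rhoC (R : realType) p n le_pn rho (X : 'M[R]_(n + n, p + p)) Xp :
  SpStiefel p n X -> is_perp X Xp ->
  forall A B, g_rho le_pn rho X Xp A B = g_rho le_pn rho X Xp B A.
Proof.
move=> XSp perp A B; have [M [_ _ gE]] := g_rhoE le_pn rho XSp perp.
rewrite !gE; congr (_ * _ + _);
  by rewrite -[LHS]mxtrace_tr trmx_mul trmxK.
Qed.

Lemma g_rho_definite (R : realType) p n le_pn rho
    (X : 'M[R]_(n + n, p + p)) Xp :
  0 < rho -> SpStiefel p n X -> is_perp X Xp ->
  forall Z, g_rho le_pn rho X Xp Z Z = 0 -> Z = 0.
Proof.
move=> rho0 XSp perp Z; have [M [_ inj gE]] := g_rhoE le_pn rho XSp perp.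
have rhoV0 : 0 < rho^-1 by rewrite invr_gt0.
move=> /eqP; rewrite gE paddr_eq0 ?mulr_ge0 ?mxtrace_gram_ge0 ?ltW //.
rewrite mulf_eq0 gt_eqF //= => /andP[/eqP D0 /eqP M0].
by apply: inj; exact: mxtrace_gram_eq0.
Qed.

Lemma g_rhoBl (R : realType) p n (le_pn : (p <= n)%N) (rho : R)
    (X : 'M[R]_(n + n, p + p)) Xp Z A B :
  g_rho le_pn rho X Xp (A - B) Z
  = g_rho le_pn rho X Xp A Z - g_rho le_pn rho X Xp B Z.
Proof. by rewrite /g_rho [(_ - _)^T]linearB /= !mulmxBl linearB. Qed.

(** * Orthogonal projections *)

(** Two projections of Y differ by an element of V that is orthogonal to V. *)
Lemma orth_proj_uniq (R : realType) a b
    (g : 'M[R]_(a, b) -> 'M[R]_(a, b) -> R) (V : set 'M[R]_(a, b))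
    (Y P0 : 'M[R]_(a, b)) :
  (forall Z A B, g (A - B) Z = g A Z - g B Z) ->
  (forall Z, g Z Z = 0 -> Z = 0) ->
  (forall A B, V A -> V B -> V (A - B)) ->
  is_orth_proj g V Y P0 -> forall P, is_orth_proj g V Y P <-> P = P0.
Proof.
move=> gB g_def VB [VP0 oP0] P; split=> [[VP oP]|->]; last by split.
have VPP := VB _ _ VP VP0.
apply/eqP; rewrite -subr_eq0; apply/eqP/g_def.
have -> : g (P - P0) (P - P0) = g (Y - P0 - (Y - P)) (P - P0).
  by congr (g _ _); rewrite opprB [RHS]addrC subrKA.
by rewrite gB oP0 // oP // subrr.
Qed.

(** By symmetry of g, V is orthogonal to its orthogonal space. *)
Lemma orth_proj_compl (R : realType) a b
    (g : 'M[R]_(a, b) -> 'M[R]_(a, b) -> R) (V : set 'M[R]_(a, b))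
    (Y P : 'M[R]_(a, b)) :
  (forall A B, g A B = g B A) ->
  is_orth_proj g V Y P -> is_orth_proj g (orth_space g V) Y (Y - P).
Proof.
move=> gC [VP oP]; split=> // N oN.
by rewrite subKr gC; exact: oN.
Qed.

(** The correction X J W has D-component W = skew A and vanishing M-component, so
    g_rho only pairs W with the symmetric matrix D Z. *)
Lemma is_orth_proj_sympl (R : realType) p n le_pn rho
    (X : 'M[R]_(n + n, p + p)) Xp (Y : 'M[R]_(n + n, p + p)) :
  SpStiefel p n X -> is_perp X Xp ->
  is_orth_proj (g_rho le_pn rho X Xp) (symplTangent X) Y
    (Y - X *m symplJ p *m skewpart (symplD X *m Y)).
Proof.
move=> XSp perp; set K := skewpart _; split.
  rewrite /symplTangent /= mulmxBr (mulmxA _ (X *m _)) symplD_XJ // mul1mx.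
  by apply/matrixP => i j; rewrite !mxE; field.
have [M [ME _ gE]] := g_rhoE le_pn rho XSp perp.
move=> Z TZ; rewrite gE subKr !(mulmxA _ (X *m _)) symplD_XJ // mul1mx.
rewrite ME mul0mx trmx0 mul0mx mxtrace0 addr0.
by rewrite mxtrace_skew_sym ?mulr0 // tr_skewpart.
Qed.

Lemma orth_spaceB (R : realType) a b
    (g : 'M[R]_(a, b) -> 'M[R]_(a, b) -> R) (V : set 'M[R]_(a, b)) :
  (forall Z A B, g (A - B) Z = g A Z - g B Z) ->
  forall A B, orth_space g V A -> orth_space g V B -> orth_space g V (A - B).
Proof. by move=> gB A B oA oB Z VZ; rewrite gB oA // oB // subrr. Qed.

(** * The projections *)

Theorem proposition4p3 (R : realType) (p n : nat) (p_gt0 : (0 < p)%N)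
    (le_pn : (p <= n)%N) (rho : R) (rho_gt0 : 0 < rho)
    (X : 'M[R]_(n + n, p + p)) (X_Sp : SpStiefel p n X)
    (Xp : 'M[R]_(n + n, n + n - (p + p))) (Xp_perp : is_perp X Xp)
    (Y : 'M[R]_(n + n, p + p)) :
  let g := g_rho le_pn rho X Xp in
  let T := tangent_space (SpStiefel p n) X in
  let A := X^T *m (symplJ n)^T *m Y in
  let PY := X *m symplJ p *m sympart A
            + (1%:M - X *m symplJ p *m X^T *m (symplJ n)^T) *m Y in
  [/\ forall P, is_orth_proj g T Y P <-> P = PY,
      PY = matS X Y *m symplJ n *m X
    & forall Q, is_orth_proj g (orth_space g T) Y Q <->
                Q = X *m symplJ p *m skewpart A].
Proof.
move=> g T A PY; rewrite /T tangent_spaceE //.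
have gB Z A' B' : g (A' - B') Z = g A' Z - g B' Z by exact: g_rhoBl.
have gdef := g_rho_definite (le_pn := le_pn) rho_gt0 X_Sp Xp_perp.
have PYE : PY = Y - X *m symplJ p *m skewpart A by exact: proj_tangentE.
have proj : is_orth_proj g (symplTangent X) Y PY.
  by rewrite PYE; exact: is_orth_proj_sympl.
split.
- by apply: orth_proj_uniq => //; exact: symplTangentB.
- by rewrite PYE matS_JX.
apply: orth_proj_uniq => //; first exact: orth_spaceB.
have -> : X *m symplJ p *m skewpart A = Y - PY by rewrite PYE subKr.
by apply: orth_proj_compl => //; exact: g_rhoC.
Qed.
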